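(* Let $n\ge 1$, let $X=\operatorname{diag}(\lambda_1,\dots,\lambda_n)\in\mathfrak{gl}_n(\mathbb{C})$ be semisimple (diagonal), let $h$ be any Hessenberg function, and let the torus $T$ of invertible diagonal matrices act on $\mathrm{GL}_n(\mathbb{C})/B$ by left multiplication. Then: (1) $\mathrm{Hess}(X,h)$ is invariant under the $T$-action. (2) $(\mathrm{GL}_n(\mathbb{C})/B)^T=(\mathrm{Hess}(X,h))^T$. (3) Let $w\in S_n$ and $1\le j<k\le n$ with $w^{-1}(j)>w^{-1}(k)$, and let $\ell$ be such that $w(\ell)=j$. Then $\ell\le h(w^{-1}(k))$ if and only if $[G_{jk}(c)w]\in\mathrm{Hess}(X,h)$ for all $c\in\mathbb{C}^*$, that is, $O_{w,s_{j,k}w}\subset\mathrm{Hess}(X,h)$.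
   Context: $B\subset \mathrm{GL}_n(\mathbb{C})$ is the subgroup of upper triangular matrices, $\mathrm{GL}_n(\mathbb{C})/B$ is the full flag variety, and $[g]=gB$. The torus $T=\{\operatorname{diag}(T_1,\dots,T_n):T_i\in\mathbb{C}^*\}\subset B$ acts by $s\cdot[g]=[sg]$; a superscript $T$ denotes the fixed point set. For $g\in\mathrm{GL}_n(\mathbb{C})$, $V_j(g)$ is the span of the first $j$ columns of $g$. A Hessenberg function is a map $h:\{1,\dots,n\}\to\{1,\dots,n\}$ with $j\le h(j)$ for all $1\le j\le n$ and $h(j)\le h(j+1)$ for $1\le j\le n-1$. For $X\in\mathfrak{gl}_n(\mathbb{C})$ the Hessenberg variety is $\mathrm{Hess}(X,h)=\{gB\in \mathrm{GL}_n(\mathbb{C})/B : X V_j(g)\subseteq V_{h(j)}(g)\ \text{for all } j\}$. A permutation $w\in S_n$ is identified with the permutation matrix given by $we_i=e_{w(i)}$. $s_{j,k}$ is the transposition exchanging $j$ and $k$. For $c\in\mathbb{C}^*$, $G_{jk}(c)$ is the matrix with $1$'s on the diagonal, entry $c$ in position $(j,k)$, and $0$ elsewhere. For $w\in S_n$ and $j<k$ with $w^{-1}(j)>w^{-1}(k)$, $O_{w,s_{j,k}w}=\{[G_{jk}(c)w]:c\in\mathbb{C}^*\}$ is the one-dimensional $T$-orbit whose closure contains $[w]$ and $[s_{j,k}w]$.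
   Formalization: In (3), the implication from the orbit lying in Hess(X,h) to ℓ ≤ h(w^{-1}(k)) is proved only when λ_j ≠ λ_k, since it fails otherwise (e.g. X = 0, n = 2, h = id, w = s_{1,2}); the forward implication, (1) and (2) hold for every diagonal X. *)

(* Defs.v *)
From HB Require Import structures.
From mathcomp Require Import all_boot all_order all_fingroup all_algebra.
From mathcomp Require Import generic_quotient boolp classical_sets reals complex.

Set Implicit Arguments.
Unset Strict Implicit.
Unset Printing Implicit Defensive.

Import GRing.Theory.

Local Open Scope classical_set_scope.
Local Open Scope ring_scope.
Local Open Scope quotient_scope.

(* Indices 1, ..., n are encoded as 'I_n, hence shifted down by one. *)

Section FlagVariety.
Variables (F : fieldType) (n : nat).

Record GL := MkGL { GLmx :> 'M[F]_n; GLmxP : GLmx \in unitmx }.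

HB.instance Definition _ := [isSub for GLmx].
HB.instance Definition _ := [Choice of GL by <:].

Definition GL_one := MkGL (unitmx1 F n).

Lemma GL_mul_subproof (g g' : GL) : GLmx g *m g' \in unitmx.
Proof. by rewrite unitmx_mul !GLmxP. Qed.
Definition GL_mul (g g' : GL) := MkGL (GL_mul_subproof g g').

Lemma GL_inv_subproof (g : GL) : invmx g \in unitmx.
Proof. by rewrite unitmx_inv GLmxP. Qed.
Definition GL_inv (g : GL) := MkGL (GL_inv_subproof g).

Lemma GL_mulA : associative GL_mul.
Proof. by move=> a b c; apply: val_inj; rewrite /= mulmxA. Qed.
Lemma GL_mul1 : left_id GL_one GL_mul.
Proof. by move=> a; apply: val_inj; rewrite /= mul1mx. Qed.
Lemma GL_mulr1 : right_id GL_one GL_mul.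
Proof. by move=> a; apply: val_inj; rewrite /= mulmx1. Qed.
Lemma GL_mulV : left_inverse GL_one GL_inv GL_mul.
Proof. by move=> a; apply: val_inj; rewrite /= mulVmx ?GLmxP. Qed.
Lemma GL_mulrV : right_inverse GL_one GL_inv GL_mul.
Proof. by move=> a; apply: val_inj; rewrite /= mulmxV ?GLmxP. Qed.

HB.instance Definition _ :=
  isGroup.Build GL GL_mulA GL_mul1 GL_mulr1 GL_mulV GL_mulrV.

(* is_trig_mx means lower triangular, hence the transpose. *)
Definition borel : {pred GL} := [pred b : GL | is_trig_mx (GLmx b)^T].

Lemma borelP (b : GL) :
  reflect (forall i j : 'I_n, (j < i)%N -> GLmx b i j = 0) (b \in borel).
Proof.
apply: (iffP is_trig_mxP) => H i j ltij; first by have := H j i ltij; rewrite mxE.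
by rewrite mxE H.
Qed.

Lemma borel1 : 1%g \in borel.
Proof. by apply/borelP => i j ltji; rewrite mxE -val_eqE gtn_eqF. Qed.

Lemma borelM b c : b \in borel -> c \in borel -> (b * c)%g \in borel.
Proof.
move=> /borelP Hb /borelP Hc; apply/borelP => i j ltji.
rewrite mxE big1 // => k _; have [leik|ltki] := leqP i k.
  by rewrite (Hc k j) ?mulr0 // (leq_trans ltji).
by rewrite Hb ?mul0r.
Qed.

Lemma borelV b : b \in borel -> (b^-1)%g \in borel.
Proof.
move=> bB; have trb := bB; move/borelP: bB => Hb; apply/borelP => i j.
have nz k : GLmx b k k != 0.
  have: \det (GLmx b)^T != 0 by rewrite det_tr -unitfE -unitmxE GLmxP.
  rewrite (det_trig trb) => /prodf_neq0/(_ k isT); by rewrite mxE.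
have [m] := ubnP (j : nat); elim: m j => // m IH j; rewrite ltnS => lejm ltji.
have /(congr1 (fun A : GL => GLmx A i j)) : (b^-1 * b = 1)%g by rewrite mulVg.
rewrite !mxE -val_eqE gtn_eqF // (bigD1 j) //= big1 ?addr0.
  by move/eqP; rewrite mulf_eq0 (negPf (nz j)) orbF => /eqP.
move=> k nekj; have [ltkj|lejk] := ltnP k j.
  have := IH k (leq_trans ltkj lejm) (ltn_trans ltkj ltji).
  by rewrite /= => ->; rewrite mul0r.
by rewrite (Hb k j) ?mulr0 // ltn_neqAle eq_sym val_eqE nekj.
Qed.

Definition coset_rel : rel GL := fun g g' => (g^-1 * g')%g \in borel.

Lemma coset_rel_refl : reflexive coset_rel.
Proof. by move=> g; rewrite /coset_rel mulVg borel1. Qed.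
Lemma coset_rel_sym : symmetric coset_rel.
Proof.
move=> g g'; apply/idP/idP => /borelV; by rewrite invgM invgK.
Qed.
Lemma coset_rel_trans : transitive coset_rel.
Proof.
move=> b a c ab bc; have := borelM ab bc.
by rewrite mulgA -(mulgA a^-1%g) mulgV mulg1.
Qed.

Canonical coset_equiv :=
  EquivRel coset_rel coset_rel_refl coset_rel_sym coset_rel_trans.

Definition flag := {eq_quot coset_equiv}.
HB.instance Definition _ := EqQuotient.on flag.

Definition flag_of (g : GL) : flag := \pi_flag g.

Lemma flag_ofP (g g' : GL) :
  flag_of g = flag_of g' <-> exists2 b, b \in borel & g' = (g * b)%g.
Proof.
split=> [/eqmodP gg'|[b bB ->]]; last first.
  by apply/eqmodP; rewrite /= /coset_rel mulgA mulVg mul1g.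
by exists (g^-1 * g')%g; rewrite // mulgA mulgV mul1g.
Qed.

Definition torus : set GL := [set s | is_diag_mx (GLmx s)].

Definition flag_act (s : GL) (x : flag) : flag := flag_of (s * repr x)%g.

Lemma flag_actE (s g : GL) : flag_act s (flag_of g) = flag_of (s * g)%g.
Proof.
have /flag_ofP[b bB gE] : flag_of (repr (flag_of g)) = flag_of g by exact: reprK.
by apply/flag_ofP; exists b; rewrite // -mulgA -gE.
Qed.

Definition torus_fixed (Z : set flag) : set flag :=
  [set x | Z x /\ forall s, torus s -> flag_act s x = x].

Definition hessenberg_fun (h : 'I_n -> 'I_n) : Prop :=
  (forall j : 'I_n, (j <= h j)%N) /\
  (forall j j' : 'I_n, j' = j.+1 :> nat -> (h j <= h j')%N).

(* Because of the index shift, the columns of index at most j : 'I_n are the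
   first j + 1 ones. *)
Definition colspan (g : 'M[F]_n) (j : 'I_n) : {vspace 'cV[F]_n} :=
  <<[seq col i g | i in [pred i : 'I_n | (i <= j)%N]]>>%VS.

Definition Hess (X : 'M[F]_n) (h : 'I_n -> 'I_n) : set flag :=
  [set x | exists g : GL, x = flag_of g /\
     forall j, (linfun (mulmx X) @: colspan g j <= colspan g (h j))%VS].

(* perm_mx w has its 1's at the positions (i, w i), hence the transpose. *)
Lemma GL_perm_subproof (w : 'S_n) : (perm_mx w)^T \in @unitmx F n.
Proof. by rewrite unitmx_tr unitmx_perm. Qed.
Definition GL_perm (w : 'S_n) : GL := MkGL (GL_perm_subproof w).

Lemma GL_permE (w : 'S_n) (i : 'I_n) :
  GLmx (GL_perm w) *m delta_mx i 0 = delta_mx (w i) 0 :> 'cV_n.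
Proof.
rewrite -colE; apply/colP => k; rewrite !mxE eqxx andbT.
by rewrite eq_sym.
Qed.

Lemma GL_elem_subproof (j k : 'I_n) (ltjk : (j < k)%N) (c : F) :
  1%:M + c *: delta_mx j k \in unitmx.
Proof.
have nejk : k != j by rewrite -val_eqE gtn_eqF.
apply: (@proj1 _ (1%:M - c *: delta_mx j k \in unitmx)).
apply/andP; rewrite -unitmx_mul mulmxDl mul1mx mulmxBr mulmx1.
rewrite -scalemxAl -scalemxAr mul_delta_mx_0 // !scaler0 subr0.
by rewrite subrK unitmx1.
Qed.
Definition GL_elem (j k : 'I_n) (ltjk : (j < k)%N) (c : F) : GL :=
  MkGL (GL_elem_subproof ltjk c).

(* The orbit is determined by w, j and k; s_{j,k} w is its other endpoint. *)
Definition orbit1 (w : 'S_n) (j k : 'I_n) (ltjk : (j < k)%N) : set flag :=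
  [set flag_of (GL_elem ltjk c * GL_perm w)%g | c in [set c : F | c != 0]].

End FlagVariety.

(* Main.v *)
Require Import Defs.
From mathcomp Require Import all_boot all_order all_fingroup all_algebra.
From mathcomp Require Import boolp classical_sets reals complex.

Set Implicit Arguments.
Unset Strict Implicit.
Unset Printing Implicit Defensive.

Import Order.TTheory GRing.Theory Num.Theory.

Local Open Scope classical_set_scope.
Local Open Scope ring_scope.

(** A flag [g] lies in Hess(X, h) exactly when the matrix A of X in the basis
    formed by the columns of g (that is, the A with X g = g A) has no nonzero
    entry in a position (m, i) with h(i) < m; this is [Hess_flag_of].  All three
    parts are then computations of A.

    Invariance: a diagonal s commutes with X, so g and s g have the same A.

    Fixed points: if [g] is fixed by T, then for every s in T the matrix of s in
    the basis g is upper triangular.  X itself may be singular, but X + c is in T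
    for a suitable scalar c, and adding a scalar matrix does not affect
    triangularity.  So A is upper triangular, which suffices since i <= h(i).

    Orbits: for g = G_jk(c) w the matrix A is the diagonal matrix with entries
    lambda_(w i), plus the single entry c (lambda_j - lambda_k) in position
    (w^-1 j, w^-1 k) ([diag_mul_orbit_point]).  Hence when
    lambda_j <> lambda_k and c <> 0, the condition on A says exactly that
    w^-1 j <= h(w^-1 k).  When lambda_j = lambda_k the extra entry vanishes, A is
    diagonal, and the whole orbit lies in Hess(X, h) whatever h is. *)

Section MatrixForm.
Variables (F : fieldType) (n : nat).
Implicit Types (g b : GL F n) (X A : 'M[F]_n) (h : 'I_n -> 'I_n).

Lemma mem_colspan g (u : 'cV[F]_n) (j : 'I_n) :
  GLmx g *m u \in colspan g j <-> forall m : 'I_n, (j < m)%N -> u m 0 = 0.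
Proof.
split=> [gu m ltjm | u0]; last first.
  have -> : GLmx g *m u = \sum_i u i 0 *: col i g.
    apply/colP => r; rewrite mxE summxE; apply: eq_bigr => i _.
    by rewrite !mxE mulrC.
  apply: memv_suml => i _; have [leij|ltji] := leqP i j.
    by apply/memvZ/memv_span/fintype.imageP; exists i.
  by rewrite u0 // scale0r mem0v.
rewrite -[u](mulKmx (GLmxP g)) (coord_span (X := in_tuple _) gu).
rewrite mulmx_sumr summxE big1 // => i _.
rewrite -scalemxAr mxE.
have /fintype.imageP[r + ->] := mem_nth 0 (ltn_ord i).
rewrite inE => lerj; rewrite colE mulKmx ?GLmxP // mxE.
by rewrite -val_eqE gtn_eqF ?mulr0 // (leq_ltn_trans lerj).
Qed.

(** Right multiplication by an upper triangular matrix only adds to each column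
    multiples of earlier columns, so the column flag does not change. *)
Lemma colspan_borel g b j : b \in @borel F n -> colspan (g * b)%g j = colspan g j.
Proof.
have sub g1 b1 : b1 \in @borel F n -> (colspan (g1 * b1)%g j <= colspan g1 j)%VS.
  move=> /borelP b1B; apply/span_subvP => _ /fintype.imageP[i + ->]; rewrite inE => leij.
  rewrite colE /= -mulmxA; apply/mem_colspan => m ltjm.
  by rewrite -colE mxE b1B // (leq_ltn_trans leij).
move=> bB; apply/eqP; rewrite eqEsubv sub //=.
by rewrite -{1}[g](mulgK b) sub // borelV.
Qed.

Lemma hessenberg_fun_homo h : hessenberg_fun h ->
  forall i j : 'I_n, (i <= j)%N -> (h i <= h j)%N.
Proof.
move=> [_ hS] i [j ltjn] /=; elim: j ltjn => [|j IHj] ltjn.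
  rewrite leqn0 => /eqP i0; suff -> : i = Ordinal ltjn by [].
  exact: val_inj.
rewrite leq_eqVlt => /predU1P[ij|ltij].
  by suff -> : i = Ordinal ltjn by []; exact: val_inj.
have hSj := hS (Ordinal (ltnW ltjn)) (Ordinal ltjn) erefl.
exact: leq_trans (IHj (ltnW ltjn) ltij) hSj.
Qed.

(** Monotonicity of h makes the conditions on the spaces V_j equivalent to
    conditions on single columns: the columns i <= j of V_j are sent to V_(h i),
    which is contained in V_(h j). *)
Lemma Hess_flag_of X h g A : hessenberg_fun h -> X *m g = GLmx g *m A ->
  Hess X h (flag_of g) <-> forall m i : 'I_n, (h i < m)%N -> A m i = 0.
Proof.
move=> hessh XgA; split=> [[g' [/flag_ofP[b bB ->] XV]] m i lthim | A0].
  have := XV i; rewrite !colspan_borel // limg_span => /span_subvP XVi.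
  have /XVi : linfun (mulmx X) (col i g) \in
      [seq linfun (mulmx X) v |
         v <- [seq col r g | r in [pred r : 'I_n | (r <= i)%N]]].
    by apply/map_f/fintype.imageP; exists i; rewrite ?inE.
  rewrite lfunE /= colE mulmxA XgA -mulmxA => /mem_colspan /(_ m lthim).
  by rewrite -colE mxE.
exists g; split=> // j; rewrite limg_span; apply/span_subvP => _ /mapP[v + ->].
case/fintype.imageP=> i; rewrite inE => leij ->.
rewrite lfunE /= colE mulmxA XgA -mulmxA; apply/mem_colspan => m lthjm.
by rewrite -colE mxE A0 // (leq_ltn_trans _ lthjm) ?hessenberg_fun_homo.
Qed.

Lemma Hess_flag_act (lambda : 'rV[F]_n) h (s : GL F n) x : hessenberg_fun h ->
  torus s -> Hess (diag_mx lambda) h x -> Hess (diag_mx lambda) h (flag_act s x).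
Proof.
move=> hessh /is_diag_mxP sdiag xH; have [g [xg _]] := xH.
rewrite {}xg in xH *; rewrite flag_actE.
pose A := invmx g *m (diag_mx lambda *m g).
have XgA : diag_mx lambda *m g = GLmx g *m A by rewrite mulKVmx ?GLmxP.
apply/(Hess_flag_of (A := A) hessh); last exact/(Hess_flag_of hessh XgA).
have comm : diag_mx lambda *m s = GLmx s *m diag_mx lambda.
  apply/matrixP => r t; rewrite mul_diag_mx mul_mx_diag !mxE.
  by have [->|nert] := eqVneq r t; rewrite 1?mulrC // sdiag ?mulr0 ?mul0r.
by rewrite /= mulmxA comm -!mulmxA XgA.
Qed.

(** The matrix of diag(lambda) in the basis formed by the columns of
    G_jk(c) w.  Conjugation by G_jk(c) adds c (lambda_j - lambda_k) E_jk, and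
    conjugation by w renames the indices. *)
Lemma diag_mul_orbit_point (lambda : 'rV[F]_n) (w : 'S_n) (j k : 'I_n)
    (ltjk : (j < k)%N) (c : F) :
  diag_mx lambda *m (GL_elem ltjk c * GL_perm F w)%g =
  GLmx (GL_elem ltjk c * GL_perm F w)%g *m
    (diag_mx (\row_i lambda 0 (w i)) +
     (c * (lambda 0 j - lambda 0 k)) *: delta_mx ((w^-1)%g j) ((w^-1)%g k)).
Proof.
set X := diag_mx lambda; set P := GLmx (GL_perm F w).
pose E : 'M[F]_n := delta_mx j k.
have XP : P *m diag_mx (\row_i lambda 0 (w i)) = X *m P.
  apply/matrixP => r t; rewrite mul_mx_diag mul_diag_mx !mxE mulrC.
  by have [->|] := eqVneq (w t) r; rewrite ?mulr0.
have EP : P *m delta_mx ((w^-1)%g j) ((w^-1)%g k) = E *m P.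
  rewrite -(mul_delta_mx (0 : 'I_1)) mulmxA GL_permE permKV.
  rewrite /E -(mul_delta_mx (0 : 'I_1) j k) -[RHS]mulmxA -rowE; congr (_ *m _).
  apply/rowP => t; rewrite !mxE eqxx /=.
  by rewrite -(inj_eq (@perm_inj _ w) t) permKV.
have XE : X *m E = lambda 0 j *: E.
  apply/matrixP => r t; rewrite mul_diag_mx !mxE.
  by have [->|] := eqVneq r j; rewrite ?mulr0.
have EX : E *m X = lambda 0 k *: E.
  apply/matrixP => r t; rewrite mul_mx_diag !mxE mulrC.
  by have [->|] := eqVneq t k; rewrite ?andbF ?mulr0.
have EE : E *m E = 0 by rewrite mul_delta_mx_0 // -val_eqE gtn_eqF.
rewrite /= -/P -/E -[RHS]mulmxA mulmxDr -scalemxAr XP EP scalemxAl -mulmxDl.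
rewrite !mulmxA; congr (_ *m _).
rewrite mulmxDr mulmx1 -scalemxAr XE mulmxDl mul1mx mulmxDr -!scalemxAl.
rewrite -scalemxAr EE EX !scaler0 addr0 !scalerA -addrA -scalerDl.
by rewrite mulrBr subrK.
Qed.

Lemma Hess_orbit_point (lambda : 'rV[F]_n) h (w : 'S_n) (j k : 'I_n)
    (ltjk : (j < k)%N) (c : F) : hessenberg_fun h ->
  Hess (diag_mx lambda) h (flag_of (GL_elem ltjk c * GL_perm F w)%g) <->
  (((w^-1)%g j <= h ((w^-1)%g k))%N \/ c * (lambda 0 j - lambda 0 k) = 0).
Proof.
move=> hessh; rewrite (Hess_flag_of hessh (diag_mul_orbit_point _ _ _ _)).
split=> [A0 | disj m i lthim].
  have [|lth] := leqP ((w^-1)%g j) (h ((w^-1)%g k)); first by left.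
  right; have := A0 _ _ lth; rewrite !mxE !eqxx mulr1.
  rewrite -val_eqE gtn_eqF ?add0r //; exact: leq_ltn_trans (hessh.1 _) lth.
rewrite !mxE -val_eqE gtn_eqF ?add0r; last exact: leq_ltn_trans (hessh.1 _) lthim.
case: disj => [le|->]; last by rewrite mul0r.
case: eqP => [mE|_]; last by rewrite mulr0.
case: eqP => [iE|_]; last by rewrite mulr0.
by move: lthim; rewrite mE iE ltnNge le.
Qed.

End MatrixForm.

(** Any c larger than all the absolute values |lambda_i| avoids the finitely
    many -lambda_i. *)
Lemma exists_shift_unitmx (F : numFieldType) n (lambda : 'rV[F]_n) :
  exists c : F, diag_mx lambda + c%:M \in unitmx.
Proof.
pose c := 1 + \sum_i `|lambda 0 i|; exists c.
rewrite -diag_const_mx -raddfD unitmxE det_diag unitfE.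
apply/prodf_neq0 => i _; rewrite !mxE.
rewrite addr_eq0; apply/negP => /eqP lam_c.
have lt_c : `|lambda 0 i| < c.
  rewrite /c (bigD1 i) //= addrCA ltrDl ltr_wpDr ?ltr01 //.
  by apply: sumr_ge0 => r _.
have c_gt0 : 0 < c := le_lt_trans (normr_ge0 _) lt_c.
by move: lt_c; rewrite lam_c normrN gtr0_norm // ltxx.
Qed.

Lemma torus_fixed_sub_Hess (F : numFieldType) n (lambda : 'rV[F]_n)
    (h : 'I_n -> 'I_n) (x : flag F n) : hessenberg_fun h ->
  (forall s, torus s -> flag_act s x = x) -> Hess (diag_mx lambda) h x.
Proof.
move=> hessh; have [g ->] : exists g : GL F n, x = flag_of g.
  by exists (generic_quotient.repr x); rewrite /flag_of generic_quotient.reprK.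
move=> xfix.
have [c shiftU] := exists_shift_unitmx lambda.
pose s := MkGL shiftU.
have sT : torus s.
  by rewrite /torus /= -diag_const_mx -raddfD diag_mx_is_diag.
have := xfix s sT; rewrite flag_actE => /esym /flag_ofP[b bB /(congr1 (@GLmx _ _))].
rewrite /= mulmxDl mul_scalar_mx => /(canRL (addrK _)) Xg.
have XgA : diag_mx lambda *m g = GLmx g *m (GLmx b - c%:M).
  by rewrite Xg mulmxBr mul_mx_scalar.
apply/(Hess_flag_of hessh XgA) => m i lthim.
have ltim : (i < m)%N := leq_ltn_trans (hessh.1 i) lthim.
move/borelP: bB => bB.
by rewrite !mxE bB // -val_eqE gtn_eqF // mulr0n subr0.
Qed.

Theorem theorem3p4 (R : realType) (n : nat) (n_gt0 : (0 < n)%N)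
    (lambda : 'rV[R[i]]_n) (h : 'I_n -> 'I_n) (hessh : hessenberg_fun h) :
  let X : 'M[R[i]]_n := diag_mx lambda in
  [/\ (forall (s : GL R[i] n) (x : flag R[i] n),
         torus s -> Hess X h x -> Hess X h (flag_act s x)),
      torus_fixed [set: flag R[i] n] = torus_fixed (Hess X h)
    & forall (w : 'S_n) (j k : 'I_n) (ltjk : (j < k)%N) (l : 'I_n),
        ((w^-1)%g k < (w^-1)%g j)%N -> w l = j ->
        let orbit_points_in_Hess := forall c : R[i], c != 0 ->
          Hess X h (flag_of (GL_elem ltjk c * GL_perm R[i] w)%g) in
        [/\ lambda 0 j != lambda 0 k ->
              ((l <= h ((w^-1)%g k))%N <-> orbit_points_in_Hess),
            (l <= h ((w^-1)%g k))%N -> orbit_points_in_Hess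
          & orbit_points_in_Hess <-> orbit1 w ltjk `<=` Hess X h]].
Proof.
move=> X; split=> [s x|| w j k ltjk l _ wl orbit_points_in_Hess].
- exact: Hess_flag_act.
- apply/seteqP; split=> x [_ xfix]; split=> //; exact: torus_fixed_sub_Hess.
have lE : (w^-1)%g j = l by rewrite -wl permK.
have pts : (l <= h ((w^-1)%g k))%N -> orbit_points_in_Hess.
  by move=> le c _; apply/Hess_orbit_point => //; left; rewrite lE.
split=> //; last first.
  by split=> [pH _ [c c0 <-]|oH c c0]; [exact: pH | apply: oH; exists c].
move=> ne_jk; split=> // /(_ 1 (oner_neq0 _)) /(Hess_orbit_point _ _ _ _ hessh).
rewrite lE mul1r => -[//|/eqP]; by rewrite subr_eq0 (negPf ne_jk).
Qed.
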